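(* Let $u$ be a field ordinal. Then $\overline{u} = \sup\{\overline{u}^n \mid n \in \mathbb{N}, n \geq 1\}$, where $\overline{u}$ is the algebraic closure of $u$ in $\mathrm{On}_2$ and $\overline{u}^n$ is the $n$-closure of $u$ in $\mathrm{On}_2$ (all of these are ordinals).
   Context: $\oplus$ and $\otimes$ denote Nim-sum and Nim-product of ordinals, defined recursively by $\alpha \oplus \beta = \operatorname{mex}\{\alpha' \oplus \beta, \alpha \oplus \beta' \mid \alpha'<\alpha, \beta'<\beta\}$ and $\alpha \otimes \beta = \operatorname{mex}\{(\alpha' \otimes \beta) \oplus (\alpha \otimes \beta') \oplus (\alpha' \otimes \beta') \mid \alpha'<\alpha, \beta'<\beta\}$, where $\operatorname{mex}(S)$ is the least ordinal not in $S$. With these operations the class of ordinals is a Field of characteristic 2, denoted $\mathrm{On}_2$. An ordinal $u$ is identified with the set of smaller ordinals; a field ordinal is an ordinal $u$ that is a subfield of $\mathrm{On}_2$. $\overline{u}$ is the set of all ordinals that are algebraic over $u$ (Nim operations). For an integer $n \geq 1$, a field $F$ is $n$-closed if every non-constant polynomial in $F[X]$ of degree at most $n$ has at least one root in $F$. The $n$-closure $\overline{u}^n$ is the intersection of all $n$-closed fields $F$ with $u \subset F \subset \overline{u}$. *)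

(* Defs.v *)
From HB Require Import structures.
From mathcomp Require Import all_boot all_order all_algebra.
From mathcomp Require Import generic_quotient.
From mathcomp Require Import ring.
From mathcomp Require Import mathcomp_extra boolp classical_sets.

Set Implicit Arguments.
Unset Strict Implicit.
Unset Printing Implicit Defensive.

Import Order.TTheory GRing.Theory.

Local Open Scope classical_set_scope.

(** * Ordinals *)

(* [Sup f] denotes the least ordinal greater than all the [f a].  Every       *)
(* family indexed by a type of the universe of [A] has such a bound, so that  *)
(* the ordinals below form a proper class with respect to that universe.      *)
Inductive tree : Type := Sup (A : Type) (f : A -> tree).

(* Comparison of the ordinals denoted by [s] and [t]; [On] is the quotient of *)
(* [tree] by equality of denotations.                                         *)
Fixpoint tle (s t : tree) : Prop :=
  let: Sup A f := s in let: Sup B g := t in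
  forall a : A, exists b : B, tle (f a) (g b).

Definition tlt (s t : tree) : Prop :=
  let: Sup B g := t in exists b : B, tle s (g b).

Lemma tle_refl s : tle s s.
Proof. by elim: s => A f IH /= a; exists a. Qed.

Lemma tle_trans s t r : tle s t -> tle t r -> tle s r.
Proof.
elim: s t r => A f IH [B g] [C h] /= fg gh a.
have [b fgb] := fg a; have [c gch] := gh b.
by exists c; apply: IH fgb gch.
Qed.

Lemma tleNlt s t : ~ tle s t -> tlt t s.
Proof.
elim: s t => A f IH [B g] /= /existsNP[a /forallNP nfg].
exists a; rewrite -/(tle (Sup g) (f a)).
have gf b : tlt (g b) (f a) by apply: IH.
by move: gf; case: (f a) => C h.
Qed.

Lemma tlt_nle s t : tlt s t -> ~ tle t s.
Proof.
elim: t s => B g IH [A f] /= [b fgb] gf; have [a gfa] := gf b.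
apply: (IH b (f a)) gfa.
by move: fgb; case: (g b) => C h /= /(_ a).
Qed.

Lemma tltW s t : tlt s t -> tle s t.
Proof.
elim: t s => B g IH [A f] /= [b fgb] a; exists b; apply: IH.
by move: fgb; case: (g b) => C h /=.
Qed.

Lemma tlt_le_trans s t r : tlt s t -> tle t r -> tlt s r.
Proof.
case: t r => A f [B g] /= [a sfa] /(_ a)[b fgb].
by exists b; apply: tle_trans fgb.
Qed.

Definition teq (s t : tree) : bool := `[< tle s t /\ tle t s >].

Lemma teq_refl : reflexive teq.
Proof. by move=> s; apply/asboolP; split; apply: tle_refl. Qed.

Lemma teq_sym : symmetric teq.
Proof. by move=> s t; apply/asboolP/asboolP => -[]. Qed.

Lemma teq_trans : transitive teq.
Proof.
move=> t s r /asboolP[st ts] /asboolP[tr rt].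
by apply/asboolP; split; [apply: tle_trans tr | apply: tle_trans ts].
Qed.

HB.instance Definition _ := gen_eqMixin tree.
HB.instance Definition _ := gen_choiceMixin tree.

Canonical teq_equiv := EquivRel teq teq_refl teq_sym teq_trans.

Definition On : Type := {eq_quot teq}%qT.
HB.instance Definition _ := Choice.on On.

Definition tree_of (x : On) : tree := @repr _ {eq_quot teq}%qT x.
Definition On_of (t : tree) : On := \pi_({eq_quot teq})%qT t.

Lemma tree_ofK : cancel tree_of On_of.
Proof. by move=> x; rewrite /On_of /tree_of reprK. Qed.

Lemma On_ofK t : tle t (tree_of (On_of t)) /\ tle (tree_of (On_of t)) t.
Proof.
suff /eqmodP/asboolP[] : On_of t = On_of (tree_of (On_of t)) by [].
by rewrite tree_ofK.
Qed.

Definition On_le (x y : On) : bool := `[< tle (tree_of x) (tree_of y) >].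

Lemma On_le_refl : reflexive On_le.
Proof. by move=> x; apply/asboolP/tle_refl. Qed.

Lemma On_le_anti : antisymmetric On_le.
Proof.
move=> x y /andP[/asboolP xy /asboolP yx].
rewrite -[x]tree_ofK -[y]tree_ofK; apply/eqmodP.
by apply/asboolP.
Qed.

Lemma On_le_trans : transitive On_le.
Proof.
move=> y x z /asboolP xy /asboolP yz; apply/asboolP.
exact: tle_trans xy yz.
Qed.

Lemma On_le_total : total On_le.
Proof.
move=> x y; apply/orP.
have [xy|/tleNlt/tltW yx] := pselect (tle (tree_of x) (tree_of y)).
  by left; apply/asboolP.
by right; apply/asboolP.
Qed.

Fact On_display : Order.disp_t. Proof. exact: Order.Disp tt tt. Qed.

HB.instance Definition _ :=
  Order.Le_isPOrder.Build On_display On On_le_refl On_le_anti On_le_trans.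
HB.instance Definition _ := Order.POrder_isTotal.Build On_display On On_le_total.

Lemma On_leP (x y : On) : reflect (tle (tree_of x) (tree_of y)) (x <= y)%O.
Proof. exact: asboolP. Qed.

Lemma On_ltP (x y : On) : reflect (tlt (tree_of x) (tree_of y)) (x < y)%O.
Proof.
rewrite ltNge; apply: (iffP negP) => [nyx|/tlt_nle nyx].
  by apply: tleNlt => /On_leP.
by move=> /On_leP /nyx.
Qed.

Lemma On_wf : well_founded (fun x y : On => (x < y)%O).
Proof.
suff H t (x : On) : tle (tree_of x) t -> Acc (fun x y : On => (x < y)%O) x.
  by move=> x; apply: (H (tree_of x)); apply: tle_refl.
elim: t x => A f IH x xf; constructor => y /On_ltP yx.
by have [a ya] := tlt_le_trans yx xf; apply: IH ya.
Qed.

Lemma On_ind_lt (P : On -> Prop) :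
  (forall x, (forall y, (y < x)%O -> P y) -> P x) -> forall x, P x.
Proof. by move=> H; apply: (well_founded_ind On_wf). Qed.

(* The ordinal [u] as the set of smaller ordinals.                            *)
Definition below (u : On) : set On := [set x | (x < u)%O].

Definition On_sup (A : Type) (f : A -> On) : On :=
  On_of (Sup (fun a => tree_of (f a))).

Lemma On_sup_lt (A : Type) (f : A -> On) a : (f a < On_sup f)%O.
Proof.
apply/On_ltP; apply: (@tlt_le_trans _ (Sup (fun a => tree_of (f a)))).
  by exists a; apply: tle_refl.
by case: (On_ofK (Sup (fun a => tree_of (f a)))).
Qed.

(* Subtrees, the root included, indexed by a type of the universe of [Sup].   *)
Fixpoint subtree (t : tree) : Type :=
  let: Sup A f := t in option {a : A & subtree (f a)}.

Fixpoint subtree_val (t : tree) : subtree t -> tree :=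
  match t with
  | Sup A f => fun p => match p with
    | None => Sup f
    | Some (existT a q) => subtree_val q
    end
  end.

Lemma subtree_surj t (x : On) : tle (tree_of x) t ->
  exists p : subtree t, x = On_of (subtree_val p).
Proof.
elim: t x => A f IH x xf.
have [xf'|/tleNlt[a /IH[p xE]]] := pselect (tle (Sup f) (tree_of x)).
  exists None => /=; rewrite -[LHS]tree_ofK; apply/eqmodP.
  exact/asboolP.
by exists (Some (existT _ a p)).
Qed.

Definition bounded (S : set On) := exists v, S `<=` below v.

Lemma bounded_range (A : Type) (i : A -> tree) (f : On -> On) :
  bounded [set f (On_of (i a)) | a in setT].
Proof.
exists (On_sup (fun a => f (On_of (i a)))) => _ [a _ <-].
exact: (On_sup_lt (fun a => f (On_of (i a)))).
Qed.

Lemma sub_bounded S T : S `<=` T -> bounded T -> bounded S.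
Proof. by move=> ST [v Tv]; exists v; apply: subset_trans Tv. Qed.

Lemma bounded_image u (f : On -> On) : bounded (f @` below u).
Proof.
apply: sub_bounded (bounded_range (@subtree_val (tree_of u)) f).
move=> _ [x xu <-]; have [p ->] : exists p : subtree (tree_of u), x = On_of (subtree_val p).
  by apply: subtree_surj; apply/On_leP/ltW.
by exists p.
Qed.

Lemma bounded_image2 u v (f : On -> On -> On) :
  bounded [set f x y | x in below u & y in below v].
Proof.
have [g gP] := choice (fun x => bounded_image v (f x)).
have [w wP] := bounded_image u g; exists w => _ [x xu] [y yv <-].
by apply: (@lt_trans _ _ (g x)); [apply: gP; exists y | apply: wP; exists x].
Qed.

Lemma boundedU S T : bounded S -> bounded T -> bounded (S `|` T).
Proof.
move=> [v Sv] [w Tw]; exists (Order.max v w) => x [/Sv xv|/Tw xw];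
  by rewrite /below /= lt_max ?xv ?xw ?orbT.
Qed.

Lemma On_least (P : set On) x : P x ->
  exists2 y, P y & forall z, P z -> (y <= z)%O.
Proof.
elim/On_ind_lt: x => x IH Px.
have [[y yx Py]|nP] := pselect (exists2 y, (y < x)%O & P y); first exact: IH Py.
exists x => // z Pz; rewrite leNgt; apply/negP => zx; apply: nP.
by exists z.
Qed.

(** * Nim operations *)

Definition On0 : On := On_of (Sup (fun x : False => match x with end)).

Lemma On0_le x : (On0 <= x)%O.
Proof.
apply/On_leP; apply: tle_trans (On_ofK _).2 _.
by case: (tree_of x) => A f [].
Qed.

(* The default value [On0] is irrelevant: [mex] is only used for bounded [S]. *)
Definition mex (S : set On) : On :=
  xget On0 [set x | ~ S x /\ forall y, ~ S y -> (x <= y)%O].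

Lemma mex_lt S x : (x < mex S)%O -> S x.
Proof.
rewrite /mex; case: xgetP => [m _ [nSm mP]|_]; last by rewrite ltNge On0_le.
by move=> xm; apply: contrapT => /mP; rewrite leNgt xm.
Qed.

Lemma mexP S : bounded S -> ~ S (mex S).
Proof.
move=> [v Sv]; have nSv : ~ S v by move=> /Sv; rewrite /below /= ltxx.
have [m nSm mP] := @On_least (~` S) v nSv.
by have [] : [set x | ~ S x /\ forall y, ~ S y -> (x <= y)%O] (mex S)
  by apply: xgetPex; exists m.
Qed.

Lemma mex_eq S x : bounded S -> below x `<=` S -> ~ S x -> mex S = x.
Proof.
move=> bS xS nSx; case: (ltgtP (mex S) x) => // [/xS /(mexP bS)//|/mex_lt //].
Qed.

Lemma FixE (A : Type) (r : A -> A -> Prop) (wf : well_founded r)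
    (P : A -> Type) (F : forall x, (forall y, r y x -> P y) -> P x) x :
  Fix wf P F x = F x (fun y _ => Fix wf P F y).
Proof.
apply: Fix_eq => y f g fg; congr F.
by do 2![apply: functional_extensionality_dep => ?]; apply: fg.
Qed.

(* The recursive equations defining [nim_add] and [nim_mul] are [nim_addE]    *)
(* and [nim_mulE].                                                            *)
Definition nim_add : On -> On -> On :=
  Fix On_wf (fun _ => On -> On) (fun a adda =>
  Fix On_wf (fun _ => On) (fun b addb =>
    mex [set x | (exists a' (lt : (a' < a)%O), x = adda a' lt b) \/
                 (exists b' (lt : (b' < b)%O), x = addb b' lt)])).

Lemma nim_addE a b : nim_add a b =
  mex ([set nim_add a' b | a' in below a] `|` [set nim_add a b' | b' in below b]).
Proof.
have E := FixE On_wf _ : forall x, nim_add x = _.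
rewrite {1}E FixE /=; congr mex; apply/seteqP; split => z.
  move=> [[a' [lt ->]]|[b' [lt ->]]]; [left|right]; first by exists a'.
  by exists b' => //; rewrite E.
move=> [[a' lt <-]|[b' lt <-]]; [left|right]; first by exists a', lt.
by exists b', lt; rewrite E.
Qed.

Local Notation "a ⊕ b" := (nim_add a b) (at level 50, left associativity).

Definition nim_mul : On -> On -> On :=
  Fix On_wf (fun _ => On -> On) (fun a mula =>
  Fix On_wf (fun _ => On) (fun b mulb =>
    mex [set x | exists a' (lta : (a' < a)%O) b' (ltb : (b' < b)%O),
                 x = mula a' lta b ⊕ mulb b' ltb ⊕ mula a' lta b'])).

Local Notation "a ⊗ b" := (nim_mul a b) (at level 40, left associativity).

Lemma nim_mulE a b : a ⊗ b =
  mex [set (a' ⊗ b) ⊕ (a ⊗ b') ⊕ (a' ⊗ b') | a' in below a & b' in below b].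
Proof.
have E := FixE On_wf _ : forall x, nim_mul x = _.
rewrite {1}E FixE /=; congr mex; apply/seteqP; split => z.
  move=> [a' [lta [b' [ltb ->]]]].
  by exists a' => //; exists b' => //; rewrite (E a).
move=> [a' lta [b' ltb <-]]; exists a', lta, b', ltb.
by rewrite (E a).
Qed.

Lemma nim_add_bounded a b : bounded
  ([set a' ⊕ b | a' in below a] `|` [set a ⊕ b' | b' in below b]).
Proof.
by apply: boundedU; [apply: (bounded_image a (nim_add^~ b))|apply: bounded_image].
Qed.

Lemma nim_mul_bounded a b : bounded
  [set (a' ⊗ b) ⊕ (a ⊗ b') ⊕ (a' ⊗ b') | a' in below a & b' in below b].
Proof.
exact: (bounded_image2 a b (fun a' b' => (a' ⊗ b) ⊕ (a ⊗ b') ⊕ (a' ⊗ b'))).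
Qed.

Lemma nim_add_lt x a b : (x < a ⊕ b)%O ->
  (exists2 a', (a' < a)%O & x = a' ⊕ b) \/ (exists2 b', (b' < b)%O & x = a ⊕ b').
Proof.
rewrite nim_addE => /mex_lt[[a' lt <-]|[b' lt <-]]; [left|right].
  by exists a'.
by exists b'.
Qed.

Lemma nim_addC : commutative nim_add.
Proof.
move=> a b; elim/On_ind_lt: a b => a IHa; elim/On_ind_lt => b IHb.
rewrite !nim_addE setUC; congr (mex (_ `|` _)); apply/seteqP; split => _ [c lt <-];
  by exists c => //; first [exact: IHa | exact: IHb | exact/esym/IHa | exact/esym/IHb].
Qed.

Lemma nim_addI a : injective (nim_add a).
Proof.
suff H b b' : (b' < b)%O -> a ⊕ b' <> a ⊕ b.
  by move=> b b' E; case: (ltgtP b b') => // /H; rewrite E.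
move=> lt E; apply: (mexP (nim_add_bounded a b)); rewrite -nim_addE -E.
by right; exists b'.
Qed.

Lemma nim_addIr a : injective (nim_add^~ a).
Proof. by move=> b c /=; rewrite ![_ ⊕ a]nim_addC => /nim_addI. Qed.

Lemma nim_add0 : right_id On0 nim_add.
Proof.
elim/On_ind_lt => a IH; rewrite nim_addE; apply: mex_eq.
- exact: nim_add_bounded.
- by move=> x xa; left; exists x => //; apply: IH.
- move=> [[x xa]|[x]]; last by rewrite /below /= ltNge On0_le.
  by rewrite IH // => E; move: xa; rewrite /below /= E ltxx.
Qed.

Lemma nim_add0l : left_id On0 nim_add.
Proof. by move=> x; rewrite nim_addC nim_add0. Qed.

Lemma nim_addxx a : a ⊕ a = On0.
Proof.
elim/On_ind_lt: a => a IH; rewrite nim_addE; apply: mex_eq.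
- exact: nim_add_bounded.
- by move=> x; rewrite /below /= ltNge On0_le.
- move=> [] [x xa E]; have /= := IH x xa; rewrite -E;
    [move/nim_addI|move/nim_addIr] => F; by move: xa; rewrite /below /= F ltxx.
Qed.

Lemma nim_addA : associative nim_add.
Proof.
elim/On_ind_lt => a IHa; elim/On_ind_lt => b IHb; elim/On_ind_lt => c IHc.
have neq (x y : On) : (x < y)%O -> x <> y by move=> + E; rewrite E ltxx.
case: (ltgtP (a ⊕ (b ⊕ c)) ((a ⊕ b) ⊕ c)) => // /nim_add_lt.
- move=> [[x /nim_add_lt[[a' lt ->]|[b' lt ->]]]|[c' lt]].
  + by rewrite -IHa // => /nim_addIr/esym/(neq _ _ lt).
  + by rewrite -IHb // => /nim_addI/nim_addIr/esym/(neq _ _ lt).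
  + by rewrite -IHc // => /nim_addI/nim_addI/esym/(neq _ _ lt).
- move=> [[a' lt]|[x /nim_add_lt[[b' lt ->]|[c' lt ->]]]].
  + by rewrite IHa // => /nim_addIr/nim_addIr/esym/(neq _ _ lt).
  + by rewrite IHb // => /nim_addIr/nim_addI/esym/(neq _ _ lt).
  + by rewrite IHc // => /nim_addI/esym/(neq _ _ lt).
Qed.

HB.instance Definition _ :=
  GRing.isZmodule.Build On nim_addA nim_addC nim_add0l nim_addxx.

Local Open Scope ring_scope.

Lemma On_addxx (a : On) : a + a = 0. Proof. exact: nim_addxx. Qed.

Lemma On_oppr (a : On) : - a = a.
Proof. by []. Qed.

Lemma On_addr_eq0 (a b : On) : a + b = 0 -> a = b.
Proof. by rewrite -{1}[b]On_oppr => /subr0_eq. Qed.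

Lemma On_add_eq0 (a b : On) : a = b -> a + b = 0.
Proof. by move=> ->; apply: On_addxx. Qed.

Lemma On_neq_lt (x y : On) : (x < y)%O -> x <> y.
Proof. by move=> + E; rewrite E ltxx. Qed.

Lemma nim_mul_lt x a b : (x < a ⊗ b)%O -> exists a' b',
  [/\ (a' < a)%O, (b' < b)%O & x = a' ⊗ b + a ⊗ b' + a' ⊗ b'].
Proof. by rewrite nim_mulE => /mex_lt[a' lta] [b' ltb <-]; exists a', b'. Qed.

Lemma nim_mulC : commutative nim_mul.
Proof.
elim/On_ind_lt => a IHa; elim/On_ind_lt => b IHb.
rewrite !nim_mulE; congr mex; apply/seteqP; split => _ [x lx] [y ly <-];
  exists y => //; exists x => //.
  by rewrite (IHa x lx b) (IHb y ly) (IHa x lx y) (nim_addC (b ⊗ x)).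
by rewrite (IHa y ly b) (IHb x lx) (IHa y ly x) (nim_addC (b ⊗ y)).
Qed.

Lemma nim_mul_neq a a' d d' : a <> a' -> d <> d' ->
  a ⊗ d + a' ⊗ d + a ⊗ d' + a' ⊗ d' <> 0.
Proof.
wlog la : a a' / (a' < a)%O => [H na|_].
  case: (ltgtP a a') => [la|la|//]; last exact: H.
  move=> nd; have := H _ _ la (nesym na) nd.
  by rewrite [X in X <> _ -> _](ACl (2*1*4*3)).
wlog ld : d d' / (d' < d)%O => [H nd|_].
  case: (ltgtP d d') => [ld|ld|//]; last exact: H.
  by have := H _ _ ld (nesym nd); rewrite [X in X <> _ -> _](ACl (3*4*1*2)).
rewrite -!addrA => /On_addr_eq0 E; apply: (mexP (nim_mul_bounded a d)).
by rewrite -nim_mulE E; exists a' => //; exists d' => //; rewrite !addrA.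
Qed.

Lemma nim_mulDr : right_distributive nim_mul nim_add.
Proof.
suff D a b c : a ⊗ (b + c) = a ⊗ b + a ⊗ c by [].
elim/On_ind_lt: a b c => a IHa; elim/On_ind_lt => b IHb; elim/On_ind_lt => c IHc.
have half a' b' : (a' < a)%O -> (b' < b)%O ->
    a' ⊗ (b + c) + a ⊗ (b' + c) + a' ⊗ (b' + c) =
    a' ⊗ b + a ⊗ b' + a' ⊗ b' + a ⊗ c.
  move=> la lb; rewrite !(IHa a' la) (IHb b' lb) [LHS](AC (2*2*2) (1*3*5*4*(2*6))).
  by rewrite /= On_addxx addr0.
have half' a' c' : (a' < a)%O -> (c' < c)%O ->
    a' ⊗ (b + c) + a ⊗ (b + c') + a' ⊗ (b + c') =
    a' ⊗ c + a ⊗ c' + a' ⊗ c' + a ⊗ b.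
  move=> la lc; rewrite !(IHa a' la) (IHc c' lc) [LHS](AC (2*2*2) (2*4*6*3*(1*5))).
  by rewrite /= On_addxx addr0.
have ne (x y : On) : (x < y)%O -> y <> x by move=> /On_neq_lt /nesym.
have neD (x y z : On) : (x < y)%O -> y + z <> x + z by move=> /ne n /addIr.
have neD' (x y z : On) : (x < y)%O -> z + y <> z + x by move=> /ne n /addrI.
case: (ltgtP (a ⊗ (b + c)) (a ⊗ b + a ⊗ c)) => //.
  move=> /nim_add_lt[[x /nim_mul_lt[a' [b' [la lb ->]]]]|[x /nim_mul_lt[a' [c' [la lc ->]]]]].
    rewrite -[_ ⊕ _]/(_ + _) -half // => /On_add_eq0; rewrite !addrA.
    by move/(nim_mul_neq (ne _ _ la) (neD _ _ c lb)).
  rewrite -[_ ⊕ _]/(_ + _) [a ⊗ b + _]addrC -half' // => /On_add_eq0; rewrite !addrA.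
  by move/(nim_mul_neq (ne _ _ la) (neD' _ _ b lc)).
move=> /nim_mul_lt[a' [d' [la /nim_add_lt[] [x lx ->]]]].
  rewrite -[_ ⊕ _]/(_ + _) half // => /addIr/On_add_eq0; rewrite !addrA.
  by move/(nim_mul_neq (ne _ _ la) (ne _ _ lx)).
rewrite -[_ ⊕ _]/(_ + _) half' // [a ⊗ b + a ⊗ c]addrC => /addIr/On_add_eq0; rewrite !addrA.
by move/(nim_mul_neq (ne _ _ la) (ne _ _ lx)).
Qed.

Lemma nim_mulDl : left_distributive nim_mul nim_add.
Proof. by move=> a b c; rewrite ![_ ⊗ c]nim_mulC nim_mulDr. Qed.

Lemma nim_mul0 a : a ⊗ 0 = 0.
Proof.
rewrite nim_mulE; apply: mex_eq; first exact: nim_mul_bounded.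
  by move=> x; rewrite /below /= ltNge On0_le.
by move=> [a' _ [b']]; rewrite /below /= ltNge On0_le.
Qed.

Lemma nim_mul_eq0 a b : a ⊗ b = 0 -> a = 0 \/ b = 0.
Proof.
move=> E; apply: contrapT => /not_orP[/nim_mul_neq + n]; move=> /(_ _ _ n).
by rewrite E !nim_mul0 nim_mulC nim_mul0 !addr0.
Qed.

Lemma nim_mulA : associative nim_mul.
Proof.
have DE := (nim_mulDr : forall a b c, a ⊗ (b + c) = a ⊗ b + a ⊗ c).
have DEl := (nim_mulDl : forall a b c, (a + b) ⊗ c = a ⊗ c + b ⊗ c).
elim/On_ind_lt => a IHa; elim/On_ind_lt => b IHb; elim/On_ind_lt => c IHc.
have H a' b' c' : (a' < a)%O -> (b' < b)%O -> (c' < c)%O ->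
    (a + a') ⊗ ((b + b') ⊗ (c + c')) <> 0.
  move=> la lb lc.
  by move=> /nim_mul_eq0[|/nim_mul_eq0[]] /On_addr_eq0/esym; apply: On_neq_lt.
have H' a' b' c' : (a' < a)%O -> (b' < b)%O -> (c' < c)%O ->
    ((a + a') ⊗ (b + b')) ⊗ (c + c') <> 0.
  move=> la lb lc.
  by move=> /nim_mul_eq0[/nim_mul_eq0[]|] /On_addr_eq0/esym; apply: On_neq_lt.
case: (ltgtP (a ⊗ (b ⊗ c)) ((a ⊗ b) ⊗ c)) => //.
  move=> /nim_mul_lt[x [c' [/nim_mul_lt[a' [b' [la lb ->]]] lc]]].
  rewrite !DEl -(IHc c' lc) -!(IHa a' la) -!(IHb b' lb) => /On_add_eq0 E.
  case: (H a' b' c') => //; rewrite -E !(DE, DEl).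
  by rewrite [LHS](AC ((2*2)*(2*2)) (1*((5*2*6*3)*(7*4*8)))).
move=> /nim_mul_lt[a' [x [la /nim_mul_lt[b' [c' [lb lc ->]]]]]].
rewrite !DE !(IHa a' la) !(IHb b' lb) !(IHc c' lc) => /On_add_eq0 E.
case: (H' a' b' c') => //; rewrite -E !DEl !DE !DEl.
by rewrite [LHS](AC ((2*2)*(2*2)) (1*((5*(2*3*4))*(6*7*8)))).
Qed.

Definition On1 : On := mex [set On0].

Lemma On1_bounded : bounded [set On0].
Proof.
exists (On_sup (fun _ : unit => On0)) => _ ->.
exact: (On_sup_lt (fun _ : unit => On0) tt).
Qed.

Lemma On1_neq0 : On1 != On0.
Proof. by apply/eqP => E; apply: (mexP On1_bounded); rewrite -/On1 E. Qed.

Lemma On_lt1 x : (x < On1)%O -> x = On0.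
Proof. exact: mex_lt. Qed.

Lemma On0_lt x : x <> On0 -> (On0 < x)%O.
Proof. by move=> /eqP nx; rewrite lt_neqAle eq_sym nx On0_le. Qed.

Lemma nim_mul1 : left_id On1 nim_mul.
Proof.
have m0 x : On0 ⊗ x = On0 by rewrite nim_mulC nim_mul0.
elim/On_ind_lt => b IH; rewrite nim_mulE; apply: mex_eq.
- exact: nim_mul_bounded.
- move=> x xb; exists On0; first by apply/On0_lt/eqP/On1_neq0.
  by exists x => //; rewrite !m0 nim_add0 nim_add0l IH.
- move=> [_ /On_lt1 ->] [x xb]; rewrite !m0 nim_add0 nim_add0l IH //.
  exact: On_neq_lt.
Qed.

HB.instance Definition _ :=
  GRing.Zmodule_isComNzRing.Build On nim_mulA nim_mulC nim_mul1 nim_mulDl On1_neq0.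

Lemma On_mul_lt (x a b : On) : (x < a * b)%O -> exists a' b' : On,
  [/\ (a' < a)%O, (b' < b)%O & x = a' * b + a * b' + a' * b'].
Proof. exact: nim_mul_lt. Qed.

Lemma On_mul_eq0 (a b : On) : a * b = 0 -> a = 0 \/ b = 0.
Proof. exact: nim_mul_eq0. Qed.

(* Conway's recursive description of the inverse. *)
Lemma nim_inv_ex (a : On) : exists b : On, a != 0 -> b * a = 1.
Proof.
elim/On_ind_lt: a => a IH.
have [i iP] : {i : On -> On | forall y, (y < a)%O -> y <> 0 -> i y * y = 1}.
  pose P y b := (y < a)%O -> y <> 0 -> b * y = 1.
  have [|i iP] := @choice On On P; last by exists i.
  move=> y; have [lt|n] := pselect (y < a)%O; last by exists 0.
  by have [b bP] := IH y lt; exists b => _ /eqP.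
have [->|a0] := eqVneq a 0; first by exists 0.
pose step y b := (1 + (a + y) * b) * i y.
pose K : set On := [set b | exists2 l : seq On,
  (forall y, y \in l -> (y < a)%O /\ y <> 0) & b = foldr step 0 l].
have bK : bounded K.
  pose y (p : subtree (tree_of a)) := On_of (subtree_val p).
  pose f l := foldr step 0 [seq y p | p <- l].
  exists (On_sup f) => b [l lP ->].
  suff [l' ->] : exists l', l = map y l' by exact: (On_sup_lt f).
  elim: l lP => [|z l IHl] lP; first by exists [::].
  have [|l' ->] := IHl; first by move=> t tl; apply: lP; rewrite inE tl orbT.
  have [za _] := lP z (mem_head _ _).
  have [p ->] : exists p, z = y p by apply: subtree_surj; apply/On_leP/ltW.
  by exists (p :: l').
have nK b : K b -> a * b <> 1.
  move=> [l lP ->]; elim: l lP => [|y l IHl] lP /=.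
    by rewrite mulr0 => /esym/eqP; rewrite oner_eq0.
  have [|ya y0] := lP y; first exact: mem_head.
  set b' := foldr _ _ _ in IHl *; move=> E; apply: IHl.
    by move=> t tl; apply: lP; rewrite inE tl orbT.
  have {}E : a * (1 + (a + y) * b') = y.
    by rewrite -[RHS]mul1r -[in RHS]E /step -!mulrA iP // mulr1.
  have : (a + y) * (1 + a * b') = 0.
    rewrite -[RHS](On_addxx y) -[X in _ = _ + X]E; ring.
  move=> /On_mul_eq0[/On_addr_eq0 F|/On_addr_eq0 //].
  by move: ya; rewrite F ltxx.
pose b := mex K; exists b => _; rewrite mulrC.
have Kb c : (c < b)%O -> K c by exact: mex_lt.
have b0 : b <> 0.
  move=> E; apply: (mexP bK); rewrite -/b E; exists [::] => //.
case: (ltgtP (a * b) 1) => // [/On_lt1 /On_mul_eq0[] // /eqP|/On_mul_lt].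
  by rewrite (negPf a0).
move=> [a' [b' [la lb E]]]; exfalso.
have [a'0|a'0] := eqVneq a' 0.
  by apply: (nK b' (Kb _ lb)); rewrite E a'0 !mul0r add0r addr0.
apply: (mexP bK); have [l lP b'E] := Kb _ lb.
exists (a' :: l).
  move=> y; rewrite inE => /orP[/eqP ->|/lP //]; split => //; exact/eqP.
rewrite /= -b'E /step -/b; apply/esym.
rewrite E.
have -> : a' * b + a * b' + a' * b' + (a + a') * b' = a' * b.
  by rewrite -[RHS]addr0 -(On_addxx (a * b' + a' * b')); ring.
by rewrite mulrAC [a' * _]mulrC iP ?mul1r //; apply/eqP.
Qed.


(* Equal to [0] at [a = 0], where no [b] qualifies.                           *)
Definition nim_inv (a : On) : On := xget 0 [set b | b * a = 1].

Lemma nim_mulVf (a : On) : a != 0 -> nim_inv a * a = 1.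
Proof.
move=> a0; have [b bP] := nim_inv_ex a.
exact: (@xgetI _ 0 [set b | b * a = 1] b (bP a0)).
Qed.

Lemma nim_invr0 : nim_inv 0 = 0.
Proof.
rewrite /nim_inv; case: xgetP => // b _ /= /esym/eqP.
by rewrite mulr0 oner_eq0.
Qed.

HB.instance Definition _ := GRing.ComNzRing_isField.Build On nim_mulVf nim_invr0.

(** * Closures of field ordinals *)

Definition is_subfield (F : set On) : Prop := GRing.divring_closed (mem F).

Definition field_ordinal (u : On) : Prop := is_subfield (below u).

Definition algebraic_over (F : set On) (x : On) : Prop :=
  exists p : {poly On}, [/\ p \is a polyOver (mem F), p != 0 & root p x].

Definition alg_closure (u : On) : set On := [set x | algebraic_over (below u) x].

(* [size p] is the degree of [p] plus one. *)
Definition n_closed (n : nat) (F : set On) : Prop :=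
  forall p : {poly On}, p \is a polyOver (mem F) ->
    (1 < size p <= n.+1)%N -> exists2 x, F x & root p x.

Definition n_closure (n : nat) (u : On) : set On :=
  \bigcap_(F in [set F : set On | [/\ is_subfield F, n_closed n F,
                                     below u `<=` F & F `<=` alg_closure u]]) F.

(* Main.v *)
(* Let [F] be a subfield of On_2 and [v] the least ordinal outside [F].  The   *)
(* mex recursions write every ordinal below a Nim sum, product or inverse of  *)
(* elements of [v] through elements of [F]; since [v] is not in [F], this     *)
(* makes [v] a field.  If moreover a monic [p = X^d + r] over [v] has no root *)
(* in [v], then [v] is a root of a nonzero polynomial over [v] of degree at   *)
(* most [d]: the values at [v] of polynomials over [v] of size at most [d]    *)
(* form an initial segment, so [v^d] is such a value if [v^d <= r(v)], while  *)
(* [r(v) < v^d] gives [r(v) = v^d - (v^(d-1) - y)(v - z)] with [z < v] and    *)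
(* [y] such a value, i.e. [v] is a root of [p + (X^(d-1) - q)(X - z)], which  *)
(* is nonzero as [p] does not vanish at [z].                                  *)
(* When [F] is the (bounded) algebraic closure or the [n]-closure of [u],     *)
(* such a [v] would lie in [F] (polynomials of degree at most [n] over an     *)
(* [n]-closed field split), so [v] is [n]-closed and hence [v = F]: closures  *)
(* are ordinals.  Finally, an element algebraic of degree [n] over [u] lies   *)
(* in the [n]-closure.                                                        *)

Require Import Defs.
From HB Require Import structures.
From mathcomp Require Import all_boot all_order all_algebra.
From mathcomp Require Import ring.
From mathcomp Require Import boolp classical_sets.

Set Implicit Arguments.
Unset Strict Implicit.
Unset Printing Implicit Defensive.

Import Order.TTheory GRing.Theory.

Local Open Scope classical_set_scope.
Local Open Scope ring_scope.

(** Once the closures are known to be initial segments, they are compared by inclusion: every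
    n-closure lies in the algebraic closure, and [alg_closure_n_closure] shows that the n-closures
    exhaust it. That closures are ordinals rests on the least ordinal [v] outside a subfield: [v] is
    a field ([least_notin_subfield]), and a polynomial over [v] without root in [v] makes [v] itself
    a root over [v] of no larger degree ([rootless_poly_root]). A subfield containing such roots
    therefore leaves [v] n-closed ([least_notin_n_closed]). Such a [v] exists because algebraic
    closures do not exhaust the proper class [On] ([alg_closure_bounded]). *)

(** * Subfields as field types, and algebraic elements *)

Section Subfield.
Variables (K : fieldType) (S : {pred K}) (S_subfield : GRing.divring_closed S).

(* Keyed on the closure proof, so that the structure instances can be inferred. *)
Definition subfield_pred of GRing.divring_closed S : {pred K} := S.
Local Notation P := (subfield_pred S_subfield).
HB.instance Definition _ := GRing.isDivringClosed.Build K P S_subfield.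

Definition subfield_type : Type := {x : K | x \in P}.
HB.instance Definition _ := SubChoice.on subfield_type.
HB.instance Definition _ := [SubChoice_isSubIntegralDomain of subfield_type by <:].
HB.instance Definition _ := [SubIntegralDomain_isSubField of subfield_type by <:].

Let val_sub : {rmorphism subfield_type -> K} := val.

Lemma polyOver_subfieldP (p : {poly K}) :
  reflect (exists q, p = map_poly val_sub q) (p \is a polyOver P).
Proof.
apply: (iffP idP) => [pS|[q ->]]; last first.
  by apply/polyOverP => i; rewrite coef_map; apply: valP.
exists (\poly_(i < size p) insubd (0 : subfield_type) p`_i).
apply/polyP => i; rewrite coef_map coef_poly.
case: ltnP => [_|/(nth_default 0) ->]; last exact/esym/(rmorph0 val_sub).
by rewrite /val_sub /= insubdK //; apply: (polyOverP pS).
Qed.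

Lemma factor_polyOver (p : {poly K}) x :
  p \is a polyOver S -> x \in S -> root p x ->
  exists2 q, q \is a polyOver S & p = q * ('X - x%:P).
Proof.
move=> /polyOver_subfieldP[q ->] xS; set y : subfield_type := Sub x xS.
have -> : x = val_sub y by [].
rewrite fmorph_root => /factor_theorem[r ->].
exists (map_poly val_sub r); first by apply/polyOver_subfieldP; exists r.
by rewrite rmorphM; congr (_ * _); apply: (map_polyXsubC val_sub).
Qed.

Lemma algebraicOver_subfield x :
  algebraicOver val_sub x <->
  exists p : {poly K}, [/\ p \is a polyOver S, p != 0 & root p x].
Proof.
split=> [[p p0 px]|[_ [/polyOver_subfieldP[p ->] p0 px]]].
  exists (map_poly val_sub p); rewrite map_poly_eq0; split => //.
  by apply/polyOver_subfieldP; exists p.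
by exists p; rewrite // -(map_poly_eq0 val_sub).
Qed.

Lemma algebraic_divring_closed :
  GRing.divring_closed (fun x => `[< exists p : {poly K},
    [/\ p \is a polyOver S, p != 0 & root p x] >]).
Proof.
split=> [|x y|x y]; rewrite -!topredE /=; first apply/asboolP.
- exact/algebraicOver_subfield/algebraic1.
- move=> /asboolP/algebraicOver_subfield xS /asboolP/algebraicOver_subfield yS.
  exact/asboolP/algebraicOver_subfield/algebraic_sub.
- move=> /asboolP/algebraicOver_subfield xS /asboolP/algebraicOver_subfield yS.
  exact/asboolP/algebraicOver_subfield/algebraic_div.
Qed.

Lemma algebraic_root (p : {poly K}) x : p != 0 -> root p x ->
    (forall i, exists q : {poly K}, [/\ q \is a polyOver S, q != 0 & root q p`_i]) ->
  exists q : {poly K}, [/\ q \is a polyOver S, q != 0 & root q x].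
Proof.
move=> p0 px pS; apply/algebraicOver_subfield/integral_algebraic.
apply: (integral_root p0 px); apply/integral_poly => i.
exact/integral_algebraic/algebraicOver_subfield/pS.
Qed.

End Subfield.

(** Peel off the linear factor of a root supplied by n-closedness: [x] is that root or a root of the
    quotient, of smaller degree. *)
Lemma n_closed_root n (F : set On) (p : {poly On}) x :
    is_subfield F -> n_closed n F -> p \is a polyOver (mem F) -> p != 0 ->
  (size p <= n.+1)%N -> root p x -> F x.
Proof.
move=> hF nF; have [m] := ubnP (size p); elim: m p => // m IH p pm pF p0 pn px.
have [|y Fy py] := nF p pF; first by rewrite (root_size_gt1 p0 px).
have [|q qF pE] := factor_polyOver hF pF _ py; first by rewrite inE.
move: p0 pm pn px; rewrite pE mulf_eq0 negb_or => /andP[q0 _].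
rewrite size_Mmonic ?monicXsubC // size_XsubC addn2 /= rootM root_XsubC.
move=> qm qn /orP[qx|/eqP -> //].
by apply: (IH q) => //; apply: ltnW.
Qed.

Lemma On_mul_ltB (x a b : On) : (x < a * b)%O -> exists a' b' : On,
  [/\ (a' < a)%O, (b' < b)%O & x = a * b - (a - a') * (b - b')].
Proof.
move=> /On_mul_lt[a' [b' [la lb xE]]]; exists a', b'; split => //.
rewrite [LHS]xE -[X in _ + X]On_oppr; ring.
Qed.

(** * The least ordinal outside a subfield *)

Lemma least_notin_subfield (F : set On) v :
  is_subfield F -> below v `<=` F -> ~ F v -> field_ordinal v.
Proof.
move=> hF vF nFv.
pose P := subfield_pred hF.
have FP x : F x <-> x \in P by rewrite /P /subfield_pred inE.
(* Results of operations lie in [F], so never equal [v]; only exceeding [v] must be refuted. *)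
have lt (x : On) : F x -> ~ (v < x)%O -> (x < v)%O.
  by move=> Fx; case: ltgtP => // vx; case: nFv; rewrite vx.
have vP (x : On) : (x < v)%O -> x \in P by move=> /vF/FP.
have v0 : ((0 : On) < v)%O.
  by apply: On0_lt => v0; apply: nFv; rewrite v0; apply/FP/rpred0.
have vD (x y : On) : (x < v)%O -> (y < v)%O -> (x + y < v)%O.
  move=> xv yv; apply: lt; first by apply/FP/rpredD; apply: vP.
  move=> /nim_add_lt[[z zx vE]|[z zy vE]]; apply: nFv; rewrite vE; apply/FP/rpredD;
    apply: vP => //; exact: lt_trans yv || exact: lt_trans xv.
have vM (x y : On) : (x < v)%O -> (y < v)%O -> (x * y < v)%O.
  move=> xv yv; apply: lt; first by apply/FP/rpredM; apply: vP.
  move=> /On_mul_ltB[x' [y' [lx ly vE]]]; apply: nFv; rewrite vE; apply/FP.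
  have x'v := lt_trans lx xv; have y'v := lt_trans ly yv.
  by rewrite rpredB ?rpredM ?rpredB ?vP.
have vV (x : On) : (x < v)%O -> (x^-1 < v)%O.
  elim/On_ind_lt: x => x IH xv.
  apply: lt; first by apply/FP; rewrite rpredV vP.
  have [->|x0] := eqVneq x 0; first by rewrite invr0 ltNge (ltW v0).
  move=> vx; apply: (nFv); suff -> : v = x^-1 by apply/FP; rewrite rpredV vP.
  (* The excludents of [v * x] comprise 0 but not 1. *)
  apply: (mulIf x0); rewrite mulVf //.
  case: (ltgtP (v * x) 1) => //.
    move=> /On_lt1/eqP; rewrite mulf_eq0 (negPf x0) orbF => /eqP vE.
    by move: v0; rewrite vE ltxx.
  move=> /On_mul_ltB[y [z [yv zx E]]].
  have zv : (z < v)%O := lt_trans zx xv.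
  (* If [z = 0], then [y = x^-1 > v], against [y < v]; otherwise [E] is linear in [v] with
     coefficient [z], and solving it puts [v] in [F]. *)
  have [z0|z0] := eqVneq z 0.
    exfalso; move: E; rewrite z0 subr0 mulrBl subKr => /esym/eqP.
    rewrite -(mulVf x0) => /eqP/(mulIf x0) yE; move: vx.
    by rewrite -yE ltNge (ltW yv).
  exfalso; apply: nFv; suff -> : v = (1 - y * x + y * z) / z.
    by apply/FP; rewrite rpredM ?rpredV ?rpredD ?rpredB ?rpred1 ?rpredM ?vP.
  by apply: (mulIf z0); rewrite divfK // [in RHS]E; ring.
split=> [|x y|x y]; rewrite !inE.
- apply: lt; first exact/FP/rpred1.
  by move=> /On_lt1 vE; move: v0; rewrite vE ltxx.
- exact: vD.
- by move=> xv yv; apply: vM => //; apply: vV.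
Qed.

(** * Simplest extension: the ordinal [v] over the field [v] *)

Section SimplestExtension.
Variables (v : On) (hv : field_ordinal v).
Local Notation P := (subfield_pred hv).

Let vP (x : On) : (x < v)%O -> x \in P.
Proof. by rewrite /subfield_pred inE. Qed.

Lemma lt_horner (p : {poly On}) (x : On) :
  p \is a polyOver P -> (x < p.[v])%O ->
  exists q : {poly On}, [/\ q \is a polyOver P, (size q <= size p)%N & x = q.[v]].
Proof.
elim/poly_ind: p x => [|p c IH] x pP.
  by rewrite horner0 ltNge On0_le.
have cP : c \in P by have := polyOverP pP 0; rewrite coefD coefMX coefC add0r.
have {}pP : p \is a polyOver P.
  apply/polyOverP => i; have := polyOverP pP i.+1.
  by rewrite coefD coefMX coefC addr0.
rewrite !hornerE size_MXaddC => /nim_add_lt[[y yp ->]|[d dc ->]].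
  have [p0|p0] := eqVneq p 0.
    by move: yp; rewrite p0 horner0 mul0r ltNge On0_le.
  have [z [b [/(IH _ pP)[q [qP qp ->]] bv ->]]] := On_mul_ltB yp.
  (* Expansion of [p v - (p - q)(v - b)], where the leading terms [p v] cancel. *)
  exists (q * 'X + b *: (p - q) + c%:P); split.
  - by rewrite !rpredD ?rpredM ?polyOverX ?polyOverZ ?rpredB ?polyOverC ?cP ?vP.
  - rewrite -addrA (leq_trans (size_polyD _ _)) // geq_max.
    rewrite (leq_trans (size_polyMleq _ _)) ?size_polyX ?addn2 //=.
    rewrite (leq_trans (size_polyD _ _)) // geq_max size_polyC.
    rewrite (leq_trans (leq_b1 _)) // andbT (leq_trans (size_scale_leq _ _)) //.
    by rewrite (leq_trans (size_polyD _ _)) // geq_max size_polyN leqnSn leqW.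
  - by rewrite !hornerE -[nim_add _ _]/(_ + _); ring.
have c0 : c != 0 by apply/eqP => c0; move: dc; rewrite c0 ltNge On0_le.
exists (p * 'X + d%:P); split.
- rewrite rpredD ?rpredM ?polyOverX ?polyOverC // vP //.
  by move: cP; rewrite /subfield_pred inE; apply: lt_trans.
- by rewrite (negPf c0) andbF size_MXaddC; case: ifP.
- by rewrite !hornerE.
Qed.

(** Gains one degree over [lt_horner] applied to ['X^d]: the leading coefficient 1 has only 0 below
    it. *)
Lemma lt_exp d x : (x < v ^+ d)%O ->
  exists q : {poly On}, [/\ q \is a polyOver P, (size q <= d)%N & x = q.[v]].
Proof.
elim: d x => [|d IH] x.
  by rewrite expr0 => /On_lt1 ->; exists 0; rewrite rpred0 size_poly0 horner0.
rewrite exprSr => /On_mul_ltB[y [z [/IH[q [qP qd ->]] zv ->]]].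
exists (q * 'X + z *: ('X^d - q)); split.
- by rewrite rpredD ?rpredM ?polyOverX ?polyOverZ ?rpredB ?rpredX ?polyOverX ?vP.
- apply: leq_trans (size_polyD _ _) _; rewrite geq_max; apply/andP; split.
    by apply: leq_trans (size_polyMleq _ _) _; rewrite size_polyX addn2.
  apply: leq_trans (size_scale_leq _ _) _.
  apply: leq_trans (size_polyD _ _) _; rewrite geq_max size_polyXn leqnn /=.
  by rewrite size_polyN ltnW.
- by rewrite !hornerE; ring.
Qed.

Lemma rootless_poly_root (p : {poly On}) :
    p \is a polyOver (mem (below v)) -> (1 < size p)%N ->
    (forall x, (x < v)%O -> ~~ root p x) ->
  exists q : {poly On},
    [/\ q \is a polyOver (mem (below v)), q != 0, (size q <= size p)%N & root q v].
Proof.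
move=> pP p1 nroot.
wlog pm : p pP p1 nroot / p \is monic.
  have p0 : p != 0 by rewrite -size_poly_gt0 ltnW.
  have l0 : (lead_coef p)^-1 != 0 by rewrite invr_eq0 lead_coef_eq0.
  move=> /(_ ((lead_coef p)^-1 *: p)); rewrite size_scale //; apply.
  - by apply: (@polyOverZ _ P) => //; rewrite rpredV; apply: (polyOverP (S := P) pP).
  - by [].
  - by move=> x xv; rewrite rootZ // nroot.
  - by rewrite monicE lead_coefZ mulVf // lead_coef_eq0.
(* The degree of [p] is [d.+1]. *)
pose d := (size p).-2.
have pd : size p = d.+2 by rewrite /d; case: (size p) p1 => [|[]].
pose r := p - 'X^(d.+1).
have rP : r \is a polyOver P by rewrite rpredB // rpredX // polyOverX.
have rd : (size r <= d.+1)%N.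
  apply/leq_sizeP => j; rewrite leq_eqVlt coefB coefXn => /orP[/eqP <-|dj].
    rewrite eqxx; move/monicP: pm; rewrite /lead_coef pd /= => ->.
    by rewrite subrr.
  by rewrite (gtn_eqF dj) subr0 nth_default // pd.
have pE : p = r + 'X^(d.+1) by rewrite subrK.
move: r rP rd pE => r rP rd pE.
have root_exp (q : {poly On}) : q \is a polyOver P -> (size q <= d.+1)%N ->
    v ^+ d.+1 = q.[v] ->
    exists q : {poly On},
    [/\ q \is a polyOver (mem (below v)), q != 0, (size q <= size p)%N & root q v].
  move=> qP qd vE; exists ('X^(d.+1) - q).
  have sq : size ('X^(d.+1) - q) = d.+2.
    by rewrite size_polyDl size_polyXn // size_polyN.
  split; last by rewrite rootE !hornerE -vE subrr.
  - suff: 'X^(d.+1) - q \is a polyOver P by [].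
    by rewrite rpredB // rpredX // polyOverX.
  - by rewrite -size_poly_gt0 sq.
  - by rewrite sq pd.
case: (ltgtP (v ^+ d.+1) r.[v]) => [/(lt_horner rP)[q [qP qr /root_exp]]||].
- by apply => //; apply: leq_trans rd.
- rewrite exprSr => /On_mul_ltB[y [z [/lt_exp[q [qP qd yE]] zv rE]]].
  pose s := ('X^d - q) * ('X - z%:P).
  have sP : s \is a polyOver P.
    by rewrite rpredM // rpredB ?rpredX ?polyOverX ?polyOverC ?vP.
  have sz : root s z by rewrite rootM root_XsubC eqxx orbT.
  have ss : size s = d.+2.
    have sd : size ('X^d - q) = d.+1 by rewrite size_polyDl size_polyXn // size_polyN.
    by rewrite size_Mmonic ?monicXsubC -?size_poly_gt0 ?sd // size_XsubC addn2.
  (* At [v], [p + s] equals [2 v^(d+1)], which is 0 in characteristic 2; and [p = - s] would vanish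
     at [z < v]. *)
  exists (p + s); split.
  + by suff: p + s \is a polyOver P by []; rewrite rpredD.
  + apply/eqP => ps0; have := nroot z zv.
    by rewrite rootE -[p](addrK s) ps0 sub0r hornerN oppr_eq0 -rootE sz.
  + by rewrite (leq_trans (size_polyD _ _)) // geq_max ss pd leqnn.
  + rewrite pE rootE !hornerD rE hornerM !hornerE -yE; apply/eqP.
    by rewrite -[RHS](On_addxx (v ^+ d.+1)) exprSr; ring.
- by move=> /root_exp; apply.
Qed.

End SimplestExtension.

(** * n-closedness of the least missing ordinal; boundedness *)

Lemma polyOver_mem_sub (F G : set On) (p : {poly On}) :
  F `<=` G -> p \is a polyOver (mem F) -> p \is a polyOver (mem G).
Proof. by move=> FG; apply: polyOverS => x; rewrite !inE => /FG. Qed.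

Lemma bounded_least_notin (F : set On) :
  bounded F -> exists2 v, below v `<=` F & ~ F v.
Proof.
move=> [w Fw]; have [|v nFv vP] := @On_least (~` F) w.
  by move=> /Fw; rewrite /below /= ltxx.
by exists v => // x xv; apply: contrapT => /vP; rewrite leNgt xv.
Qed.

Lemma least_notin_n_closed n (F : set On) v :
    is_subfield F -> below v `<=` F -> ~ F v ->
    (forall (p : {poly On}) x, p \is a polyOver (mem F) -> p != 0 ->
      (size p <= n.+1)%N -> root p x -> F x) ->
  field_ordinal v /\ n_closed n (below v).
Proof.
move=> hF vF nFv rootF; have hv := least_notin_subfield hF vF nFv.
split=> // p pv /andP[p1 pn]; apply: contrapT => /forall2NP nroot.
have [|q [qv q0 qp qroot]] := rootless_poly_root hv pv p1.
  by move=> x xv; apply/negP => px; case: (nroot x).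
apply: nFv; apply: rootF qroot => //; first exact: polyOver_mem_sub qv.
exact: leq_trans pn.
Qed.

Lemma bounded_roots (p : {poly On}) : p != 0 -> bounded [set x | root p x].
Proof.
have [n] := ubnP (size p); elim: n p => // n IH p pn p0.
have [[y /factor_theorem[q pE]]|nroot] := pselect (exists y, root p y); last first.
  by exists 0 => x px; case: nroot; exists x.
move: p0 pn; rewrite pE mulf_eq0 negb_or => /andP[q0 _].
rewrite size_Mmonic ?monicXsubC // size_XsubC addn2 /= ltnS => /IH/(_ q0) bq.
(* [On_sup] of a one-element family is a strict upper bound of [y]. *)
apply: sub_bounded (boundedU bq (bounded_image (On_sup (fun _ : unit => y)) id)).
move=> x /=; rewrite rootM root_XsubC => /orP[qx|/eqP ->]; first by left.
by right; exists y => //; apply: (On_sup_lt (fun _ : unit => y) tt).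
Qed.

(** Polynomials over [u] are coded by lists of subtrees of [u], a type small enough to index
    [On_sup]; each nonzero one has bounded roots. *)
Lemma alg_closure_bounded u : bounded (alg_closure u).
Proof.
have [|f fP] := @choice {poly On} On
    (fun p w => p != 0 -> [set x | root p x] `<=` below w).
  move=> p; have [->|/bounded_roots[w wP]] := eqVneq p 0; last by exists w.
  by exists 0.
pose y (i : subtree (tree_of u)) := On_of (subtree_val i).
exists (On_sup (fun s => f (Poly (map y s)))) => x [p [pu p0 px]].
suff [s pE] : exists s, p = Poly (map y s).
  have /= := fP p p0 x px; rewrite pE => /lt_trans; apply.
  exact: (On_sup_lt (fun s => f (Poly (map y s)))).
suff [s sE] : exists s, polyseq p = map y s.
  by exists s; rewrite -sE polyseqK.
have : {subset polyseq p <= mem (below u)} by apply/allP.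
elim: (polyseq p) => [|c s IH] cu; first by exists [::].
have [|s' ->] := IH; first by move=> t ts; apply: cu; rewrite inE ts orbT.
have := cu c (mem_head _ _); rewrite inE => /ltW cu'.
have [i ->] : exists i, c = y i by apply: subtree_surj; apply/On_leP.
by exists (i :: s').
Qed.

(** * Closures of a field ordinal are ordinals *)

Section FieldOrdinal.
Variables (u : On) (hu : field_ordinal u).

Lemma alg_closure_subfield : is_subfield (alg_closure u).
Proof. exact: (algebraic_divring_closed hu). Qed.

Lemma sub_alg_closure : below u `<=` alg_closure u.
Proof.
move=> x xu; exists ('X - x%:P); rewrite polyXsubC_eq0 root_XsubC; split => //.
suff: 'X - x%:P \is a polyOver (subfield_pred hu) by [].
by rewrite polyOverXsubC /subfield_pred inE.
Qed.

Lemma alg_closure_root (p : {poly On}) x :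
  p \is a polyOver (mem (alg_closure u)) -> p != 0 -> root p x -> alg_closure u x.
Proof.
move=> pF p0 px; apply: (algebraic_root hu p0 px) => i.
by have := polyOverP (S := subfield_pred alg_closure_subfield) pF i;
  rewrite /subfield_pred inE.
Qed.

Lemma alg_closure_ordinal :
  exists2 v, below v = alg_closure u & forall n, n_closed n (below v).
Proof.
have [v vF nFv] := bounded_least_notin (alg_closure_bounded u).
have hv n := least_notin_n_closed alg_closure_subfield vF nFv
  (fun p x pF p0 (_ : (size p <= n.+1)%N) => alg_closure_root pF p0).
exists v; last by move=> n; have [] := hv n.
apply/seteqP; split => // x [p [pu p0 px]].
have [fv nv] := hv (size p).
apply: (n_closed_root fv nv _ p0 (leqnSn _) px).
(* [u] is contained in [v], since otherwise [v] would belong to [u], hence to its closure. *)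
apply: polyOver_mem_sub pu => y yu; rewrite /below /= ltNge; apply/negP => vy.
by apply: nFv; apply: sub_alg_closure; apply: le_lt_trans yu.
Qed.

Lemma n_closure_subfield n : is_subfield (n_closure n u).
Proof.
split=> [|x y|x y]; rewrite !inE.
- by move=> F [[F1 _ _] _ _ _]; move: F1; rewrite inE.
- move=> xC yC F FC; have [[_ /(_ x y) + _] _ _ _] := FC.
  by rewrite !inE; apply; [apply: xC|apply: yC].
- move=> xC yC F FC; have [[_ _ /(_ x y) +] _ _ _] := FC.
  by rewrite !inE; apply; [apply: xC|apply: yC].
Qed.

Lemma sub_n_closure n : below u `<=` n_closure n u.
Proof. by move=> x xu F [_ _ + _]; apply. Qed.

Lemma n_closure_root n (p : {poly On}) x :
    p \is a polyOver (mem (n_closure n u)) -> p != 0 ->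
  (size p <= n.+1)%N -> root p x -> n_closure n u x.
Proof.
move=> pC p0 pn px F FC; have [hF nF _ _] := FC.
by apply: n_closed_root nF _ p0 pn px => //; apply: polyOver_mem_sub pC => y; apply.
Qed.

(** The algebraic closure is itself one of the intersected fields, so the intersection is not over
    an empty family. *)
Lemma n_closure_sub_alg_closure n : n_closure n u `<=` alg_closure u.
Proof.
have [v vE nv] := alg_closure_ordinal.
move=> x; apply; split=> //; first exact: alg_closure_subfield.
  by rewrite -vE.
exact: sub_alg_closure.
Qed.

Lemma n_closure_ordinal n : exists v, below v = n_closure n u.
Proof.
have [v vC nCv] := bounded_least_notin
  (sub_bounded (@n_closure_sub_alg_closure n) (alg_closure_bounded u)).
have [hv nv] := least_notin_n_closed (n_closure_subfield n) vC nCv (@n_closure_root n).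
(* [below v] is one of the intersected fields, so it contains the n-closure. *)
exists v; apply/seteqP; split => // x; apply; split => //.
  move=> y yu; rewrite /below /= ltNge; apply/negP => vy.
  by apply: nCv; apply: sub_n_closure; apply: le_lt_trans yu.
by apply: subset_trans vC _; apply: n_closure_sub_alg_closure.
Qed.

Lemma alg_closure_n_closure x :
  alg_closure u x -> exists2 n, (1 <= n)%N & n_closure n u x.
Proof.
move=> [p [pu p0 px]]; have p1 := root_size_gt1 p0 px.
exists (size p).-1; first by rewrite -ltnS prednK // ltnW.
apply: n_closure_root p0 _ px; last by rewrite prednK // ltnW.
exact: polyOver_mem_sub (@sub_n_closure _) pu.
Qed.

End FieldOrdinal.

Theorem lemma3p3 (u : On) (hu : field_ordinal u) :
  exists (ubar : On) (ubarn : nat -> On),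
    [/\ below ubar = alg_closure u,
        forall n : nat, (1 <= n)%N -> below (ubarn n) = n_closure n u
      & supremums [set ubarn n | n in [set n : nat | (1 <= n)%N]] ubar].
Proof.
have [ubar ubarE _] := alg_closure_ordinal hu.
have [ubarn ubarnE] := choice (n_closure_ordinal hu).
exists ubar, ubarn; split => //; split; last first.
  (* An upper bound [w < ubar] would be algebraic over [u], hence below some [ubarn n <= w]. *)
  move=> w wP; rewrite leNgt; apply/negP => lt.
  have : alg_closure u w by rewrite -ubarE.
  move=> /alg_closure_n_closure[n n1]; rewrite -ubarnE /below /= ltNge.
  by rewrite wP //; exists n.
move=> _ [n _ <-]; rewrite leNgt; apply/negP => lt.
have : below ubar ubar.
  by rewrite ubarE; apply: (@n_closure_sub_alg_closure u hu n); rewrite -ubarnE.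
by rewrite /below /= ltxx.
Qed.
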